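(* Let $I \subseteq [0,1)$ be a set with non-empty interior, let $a, c > 0$ with $a \neq 1$, and let $\gamma \in \mathbb{R} \setminus \{0\}$. Define $\varphi_a(x) = (\log_a x)^{-1}$ for $x>0$, $x\neq 1$. Consider the system \[ \|\theta n\| \leq \frac{c}{n^{\varphi_a(\theta) - 1}}, \qquad \{\gamma n^{\varphi_a(\theta)}\} \in I \] in the unknown $n \in \mathbb{N}$. If $a < 1$, then for Lebesgue-almost every $\theta \in (a,1)$, the system has infinitely many solutions $n \in \mathbb{N}$ if $\theta < \sqrt{a}$ and only finitely many if $\theta > \sqrt{a}$. If $a > 1$, then for Lebesgue-almost every $\theta \in (1,a)$, the system has infinitely many solutions $n \in \mathbb{N}$ if $\theta > \sqrt{a}$ and only finitely many if $\theta < \sqrt{a}$.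
   Context: $\mathbb{N}$ is the set of positive integers; $\|x\|$ denotes the distance from $x \in \mathbb{R}$ to the nearest integer and $\{x\}$ denotes the fractional part of $x$. *)

(* Defs.v *)
From HB Require Import structures.
From mathcomp Require Import all_boot all_order all_algebra.
From mathcomp Require Import all_classical all_reals all_analysis.

Set Implicit Arguments.
Unset Strict Implicit.
Unset Printing Implicit Defensive.

Import Order.TTheory GRing.Theory Num.Theory.
Import numFieldNormedType.Exports.

Local Open Scope classical_set_scope.
Local Open Scope ring_scope.

Definition dist_int (R : realType) (x : R) : R :=
  inf [set `|x - m%:~R| | m in [set: int]].

Definition fract (R : realType) (x : R) : R := x - (Num.floor x)%:~R.

Definition logb (R : realType) (a x : R) : R := ln x / ln a.

Definition phi (R : realType) (a x : R) : R := (logb a x)^-1.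

Definition solutions (R : realType) (I : set R) (a c gamma theta : R)
    : set nat :=
  [set n : nat | [/\ (0 < n)%N,
     dist_int (theta * n%:R) <= c / n%:R `^ (phi a theta - 1) &
     I (fract (gamma * n%:R `^ phi a theta))]].

(* Main.v *)
(** Write tau = phi a theta. The condition tau < 2 (resp. tau > 2) is what
    separates the two regimes, and tau > 2 is the convergence half of
    Khinchine's theorem (Borel-Cantelli).

    Let tau < 2 at a point x, and let n be a large denominator with
    |n x - p| <= 1/n. Near x the function y |-> gamma n^(phi a y) has
    derivative of order n^tau ln n, so it runs through a full period modulo 1
    on a ball of radius rho of order 1/(n^tau ln n) around x. The inequality
    |n y - p| <= c / n^(phi a y - 1) allows |y - p/n| up to order n^(-tau),
    which exceeds both rho and 1/n^2; it therefore holds on the whole ball, and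
    the solution set of n contains a subinterval whose length is a fixed
    proportion of rho. Hence no such x outside the union of the interiors of
    the solution sets of the n >= N can be a point of density of the complement
    of that union, and the Lebesgue density theorem applies. *)

Require Import Defs.
From HB Require Import structures.
From mathcomp Require Import all_boot all_order all_algebra.
From mathcomp Require Import all_classical all_reals all_analysis.
From mathcomp Require Import measurable_realfun zify ring lra.

Set Implicit Arguments.
Unset Strict Implicit.
Unset Printing Implicit Defensive.

Import Order.TTheory GRing.Theory Num.Theory.
Import numFieldNormedType.Exports.

Local Open Scope classical_set_scope.
Local Open Scope ring_scope.

(** * Rational approximation, and preimages over a full period *)

(** Pigeonhole: the Q + 1 fractional parts of [x * k], 0 <= k <= Q, fall into Q boxes of length 1/Q.
    For two indices in one box, [n] is their difference and [p] that of the floors. *)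
Lemma dirichlet_approximation (R : realType) (x : R) (Q : nat) : (0 < Q)%N ->
  exists n (p : int), (0 < n <= Q)%N /\ `|x * n%:R - p%:~R| < Q%:R^-1.
Proof.
case: Q => // Q _.
have fr (y : R) : 0 <= fract y < 1.
  by rewrite /fract subr_ge0 floor_le_tmp ltrBlDl -{2}[1]/(1%:~R) -intrD floorD1_gt.
pose f (k : 'I_Q.+2) : 'I_Q.+1 :=
  inord (Num.truncn (Q.+1%:R * fract (x * k%:R))).
have fP (k : 'I_Q.+2) :
    (f k)%:R <= Q.+1%:R * fract (x * k%:R) < (f k).+1%:R.
  have /andP[f0 f1] := fr (x * k%:R).
  have g0 : 0 <= Q.+1%:R * fract (x * k%:R) by rewrite mulr_ge0.
  rewrite inordK ?truncn_itv//.
  rewrite -(ltr_nat R); have /andP[+ _] := truncn_itv g0.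
  by move=> /le_lt_trans; apply; rewrite gtr_pMr.
have /injectivePn[i [j ij fij]] : ~~ injectiveb f.
  by apply/negP => /injectiveP/leq_card; rewrite !card_ord ltnn.
wlog ltij : i j ij fij / (i < j)%N.
  move=> wl; have [/wl|/wl|/val_inj/eqP] := ltngtP i j; first exact.
  - by apply=> //; rewrite eq_sym.
  - by rewrite (negbTE ij).
exists (j - i)%N, (Num.floor (x * j%:R) - Num.floor (x * i%:R)).
split; first by rewrite subn_gt0 ltij leq_subLR; have := ltn_ord j; lia.
have /andP[] := fP i; have /andP[] := fP j; rewrite fij /fract -[(f j).+1%:R]natr1.
set A : R := (nat_of_ord (f j))%:R; rewrite (natrB _ (ltnW ltij)) intrB => l1 u1 l2 u2.
have Q0 : 0 < Q.+1%:R :> R by [].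
rewrite -(ltr_pM2l Q0) mulfV ?gt_eqF// -[X in X * _](gtr0_norm Q0) -normrM.
by rewrite ltr_norml; lra.
Qed.

(** For rational [x], multiples of a denominator give error 0. Otherwise the errors for 0 < n < N
    have a positive lower bound [e], and Dirichlet with 1/Q < e forces [n] past [N]. *)
Lemma dirichlet_unbounded (R : realType) (x : R) (N : nat) :
  exists n (p : int), [/\ (N <= n)%N, (0 < n)%N & `|x * n%:R - p%:~R| <= n%:R^-1].
Proof.
have [[n [p [n0 xnp]]]|irr] :=
    pselect (exists n (p : int), (0 < n)%N /\ x * n%:R = p%:~R).
  exists (n * N.+1)%N, (p * N.+1%:Z); split; [nia|nia|].
  rewrite natrM mulrA xnp intrM pmulrn subrr normr0 invr_ge0//.
have [e e0 he] : exists2 e : R, 0 < e & forall n (p : int), (0 < n < N)%N ->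
    e <= `|x * n%:R - p%:~R|.
  elim: N => [|N [e e0 IH]]; first by exists 1 => // n p; rewrite ltn0 andbF.
  set y := x * N%:R; case: (posnP N) => [N0|N0].
    by exists 1 => // n p; rewrite N0; case: n.
  have y0 : 0 < y - (Num.floor y)%:~R.
    rewrite subr_gt0 lt_neqAle floor_le_tmp andbT.
    by apply/eqP => yE; apply: irr; exists N, (Num.floor y).
  have y1 : 0 < (Num.floor y)%:~R + 1 - y.
    by rewrite subr_gt0 -[1]/(1%:~R) -intrD floorD1_gt.
  exists (Num.min e (Num.min (y - (Num.floor y)%:~R) ((Num.floor y)%:~R + 1 - y))).
    by rewrite !lt_min e0 y0 y1.
  move=> n p /andP[n0]; rewrite ltnS leq_eqVlt => /predU1P[->|nN]; last first.
    by rewrite ge_min IH ?n0.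
  rewrite -/y !ge_min; apply/orP; right.
  have [pf|fp] := leP p (Num.floor y).
    apply/orP; left; apply: le_trans (ler_norm _).
    by rewrite lerD2l lerN2 ler_int.
  apply/orP; right; rewrite distrC; apply: le_trans (ler_norm _).
  by rewrite lerD2r -[1]/(1%:~R) -intrD ler_int; lia.
pose Q := (Num.truncn e^-1).+1.
have Qe : Q%:R^-1 < e.
  by rewrite invf_plt ?posrE// truncnS_gt.
have [n [p [/andP[n0 nQ] xnp]]] := dirichlet_approximation x (ltn0Sn _ : 0 < Q)%N.
exists n, p; split => //.
  rewrite leqNgt; apply/negP => nN.
  by have := he n p; rewrite n0 nN => /(_ isT); rewrite leNgt (lt_trans xnp).
by rewrite (le_trans (ltW xnp))// lef_pV2 ?posrE ?ltr0n// ler_nat.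
Qed.

(* The centre [s] is a point where [h] takes a value congruent to [(u + v) / 2]
   modulo 1: one exists because [h] varies by at least 1. *)
Lemma preimage_of_period (R : realType) (h : R -> R) (x rho D u v w : R) :
    0 < rho -> 0 < w <= rho -> 0 < D -> D * w <= (v - u) / 2 ->
    {within `[x - rho, x + rho], continuous h} ->
    (forall s t, `|s - x| <= 2 * rho -> `|t - x| <= 2 * rho ->
       `|h s - h t| <= D * `|s - t|) ->
    1 <= `|h (x + rho) - h (x - rho)| ->
  exists s (k : int), `|s - x| <= rho /\
    forall y, `|y - s| < w -> u < h y - k%:~R < v.
Proof.
move=> rho0 /andP[w0 wrho] D0 Dw hc hL h1.
pose lo := Num.min (h (x - rho)) (h (x + rho)).
(* The least [k] with [lo <= z]; then [z <= lo + 1], so [z] lies between the two endpoint values of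
   [h]. *)
pose k := Num.ceil (lo - (u + v) / 2).
pose z := k%:~R + (u + v) / 2.
have zlo : lo <= z.
  by rewrite /z -lerBlDr ceil_ge.
have zhi : z <= lo + 1.
  have := ceilB1_lt (lo - (u + v) / 2); rewrite -/k intrB /z => ?; lra.
have [||s sI hs] := @IVT R h (x - rho) (x + rho) z _ hc _.
- lra.
- apply/andP; split=> //; apply: (le_trans zhi).
  move: h1; rewrite /lo; have [ab|ab] := leP (h (x - rho)) (h (x + rho)).
    by rewrite ger0_norm ?subr_ge0//; lra.
  by rewrite ltr0_norm ?subr_lt0//; lra.
have sx : `|s - x| <= rho.
  by move: sI; rewrite in_itv/= ler_norml => /andP[? ?]; lra.
exists s, k; split=> // y ys.
have : `|h y - h s| < (v - u) / 2.
  apply: lt_le_trans Dw; apply: (@le_lt_trans _ _ (D * `|y - s|)); last first.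
    by rewrite ltr_pM2l.
  apply: hL; last by rewrite (le_trans sx)//; lra.
  rewrite (_ : y - x = (y - s) + (s - x)); last by ring.
  by rewrite (le_trans (ler_normD _ _))//; lra.
by rewrite hs /z ltr_norml => /andP[? ?]; lra.
Qed.

(** * Bi-Lipschitz and growth estimates for ln, exp and phi *)

(** Both bounds come from [ln q - ln p <= (q - p) / p], applied to the two points in either
    order. *)
Lemma ln_bilipschitz (R : realType) (b d s t : R) :
  0 < b -> b <= s <= d -> b <= t <= d ->
  d^-1 * `|s - t| <= `|ln s - ln t| <= b^-1 * `|s - t|.
Proof.
move=> b0; wlog st : s t / s <= t => [wl sb tb|].
  have [/wl->//|/ltW ts] := leP s t.
  by rewrite distrC [X in _ <= X <= _]distrC wl.
move=> /andP[bs sd] /andP[bt td].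
have s0 : 0 < s by lra.
have t0 : 0 < t by lra.
rewrite ler0_norm ?subr_le0// ler0_norm ?subr_le0 ?ler_ln ?posrE// !opprB.
have aux (p q : R) : 0 < p -> 0 < q -> ln q - ln p <= (q - p) / p.
  move=> p0 q0; rewrite -ln_div ?posrE//.
  rewrite (_ : q / p = 1 + (q - p) / p); last by field; exact: lt0r_neq0.
  apply: le_ln1Dx; rewrite mulrBl divff ?gt_eqF//.
  by have := divr_gt0 q0 p0; lra.
apply/andP; split.
  apply: (@le_trans _ _ ((t - s) / t)).
    by rewrite mulrC ler_wpM2l ?subr_ge0// lef_pV2 ?posrE//; lra.
  by have := aux t s t0 s0; rewrite -(opprB t s) mulNr; lra.
apply: (le_trans (aux _ _ s0 t0)).
by rewrite mulrC ler_wpM2r ?subr_ge0// lef_pV2 ?posrE.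
Qed.

Lemma expR_bilipschitz (R : realType) (b d p q : R) :
  b <= p <= d -> b <= q <= d ->
  expR b * `|p - q| <= `|expR p - expR q| <= expR d * `|p - q|.
Proof.
move=> /andP[bp pd] /andP[bq qd].
have := @ln_bilipschitz R (expR b) (expR d) (expR p) (expR q) (expR_gt0 _).
rewrite !ler_expR bp pd bq qd !expRK => /(_ isT isT)/andP[h1 h2].
by rewrite -!ler_pdivrMl ?expR_gt0// -ler_pdivlMl ?expR_gt0// h1 h2.
Qed.

Lemma ln_natr_unbounded (R : realType) (B : R) :
  \forall n \near \oo, B < ln (n%:R : R).
Proof.
near=> n; have Bn : expR B < n%:R.
  by near: n; exact: nbhs_infty_gtr.
by rewrite -[B]expRK ltr_ln ?posrE ?expR_gt0// (lt_trans _ Bn)// expR_gt0.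
Unshelve. all: by end_near. Qed.

Lemma powR_natr_small (R : realType) (s e : R) : 0 < s -> 0 < e ->
  \forall n \near \oo, (n%:R : R) `^ (- s) < e.
Proof.
move=> s0 e0; near=> n.
have n0 : 0 < n%:R :> R by near: n; exact: nbhs_infty_gtr.
rewrite /powR gt_eqF// -[e]lnK ?posrE// ltr_expR mulNr ltrNl -ltr_pdivrMl// mulrC.
by near: n; exact: ln_natr_unbounded.
Unshelve. all: by end_near. Qed.

Lemma phiE (R : realType) (a x : R) : phi a x = ln a / ln x.
Proof. by rewrite /phi /logb invf_div. Qed.

(** The difference of the two values is, in absolute value, |ln a| |ln s - ln t| / (|ln s| |ln t|),
    and near [x] both the argument and |ln| stay within a factor 2 of their values at [x]. *)
Lemma phi_bilipschitz (R : realType) (a x : R) :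
    0 < a -> a != 1 -> 0 < x -> x != 1 ->
  exists eta m M : R, [/\ 0 < eta, 0 < m, 0 < M &
    forall s, `|s - x| < eta -> [/\ 0 < s, s != 1 & forall t, `|t - x| < eta ->
      m * `|s - t| <= `|phi a s - phi a t| <= M * `|s - t|]].
Proof.
move=> a0 a1 x0 x1.
have la : 0 < `|ln a| by rewrite normr_gt0 ln_eq0.
have lx : 0 < `|ln x| by rewrite normr_gt0 ln_eq0.
pose l : R := `|ln x|.
have : \forall s \near x, `|s - x| < x / 2 /\ `|ln x - ln s| < l / 2.
  near=> s; split.
    rewrite distrC; near: s; apply: cvgr_dist_lt => //; lra.
  near: s; have /cvgr_dist_lt := @continuous_ln R x x0; apply; rewrite /l; lra.
move=> /nbhs_ballP[eta/= eta0 ballP].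
have P s : `|s - x| < eta -> [/\ x / 2 <= s <= 2 * x & l / 2 <= `|ln s| <= 2 * l].
  move=> sx; have [] := ballP s; first by rewrite /ball/= distrC.
  rewrite ltr_norml => /andP[s1 s2] ls; split; first by lra.
  have := lerB_dist (ln x) (ln s); have := ler_normB (ln x) (ln x - ln s).
  rewrite opprB addrCA subrr addr0 -/l => ? ?; lra.
exists eta, (`|ln a| * (2 * x)^-1 * ((2 * l) ^- 2)),
  (`|ln a| * (x / 2)^-1 * ((l / 2) ^- 2)).
have l2 : 0 < l / 2 by rewrite /l; lra.
have l2' : 0 < 2 * l by rewrite /l; lra.
split => //; rewrite ?mulr_gt0 ?invr_gt0 ?exprn_gt0//; try lra.
move=> s sx; have [sI ls] := P _ sx.
have s1 : s != 1.
  by apply: contraTneq ls => ->; rewrite ln1 normr0 -/l; lra.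
split=> //; first by lra.
move=> t tx; have [tI lt] := P _ tx.
have lsn0 : ln s != 0 by rewrite -normr_gt0; lra.
have ltn0 : ln t != 0 by rewrite -normr_gt0; lra.
have -> : `|phi a s - phi a t| = `|ln a| * `|ln s - ln t| * (`|ln s| * `|ln t|)^-1.
  rewrite distrC -!normrM -normfV -normrM !phiE; congr `|_|.
  by field; rewrite lsn0 ltn0.
have x2 : 0 < x / 2 by lra.
have /andP[b1 b2] := ln_bilipschitz x2 sI tI.
have ll0 : 0 < `|ln s| * `|ln t| by apply: mulr_gt0; lra.
have i1 : (2 * l) ^- 2 <= (`|ln s| * `|ln t|)^-1.
  rewrite lef_pV2 ?posrE ?exprn_gt0// expr2.
  by apply: ler_pM => //; case/andP: ls; case/andP: lt.
have i2 : (`|ln s| * `|ln t|)^-1 <= (l / 2) ^- 2.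
  rewrite lef_pV2 ?posrE ?exprn_gt0// expr2.
  by apply: ler_pM; rewrite ?(ltW l2)//; case/andP: ls; case/andP: lt.
apply/andP; split.
  rewrite [leLHS]mulrAC; apply: ler_pM => //.
  - by rewrite !mulr_ge0// ?invr_ge0; lra.
  - by rewrite invr_ge0 exprn_ge0//; lra.
  - by rewrite -mulrA ler_wpM2l.
by rewrite [leRHS]mulrAC; apply: ler_pM => //; rewrite -mulrA ler_wpM2l.
Unshelve. all: by end_near. Qed.

(** * Intervals of solutions near a point with exponent below 2 *)

(** What matters is that [delta] is chosen before [e] and [N]: the solution interval keeps a fixed
    proportion of the ball around [x] at arbitrarily small scales. *)
Lemma local_solutions (R : realType) (a c gamma u v x : R) :
    0 < a -> a != 1 -> 0 < c -> gamma != 0 -> u < v ->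
    0 < x -> x != 1 -> 0 < phi a x < 2 ->
  exists2 delta : R, 0 < delta & forall (e : R) (N : nat), 0 < e ->
    exists n rho s, [/\ (N <= n)%N, 0 < rho < e,
      forall y, `|y - s| < delta * rho -> `|y - x| < 2 * rho &
      forall y, `|y - s| < delta * rho -> [/\ (0 < n)%N,
        exists p : int, `|y * n%:R - p%:~R| <= c / n%:R `^ (phi a y - 1) &
        exists k : int, u < gamma * n%:R `^ phi a y - k%:~R < v]].
Proof.
move=> a0 a1 c0 gamma0 uv x0 x1 /andP[tau0 tau2].
have [eta [m [M [eta0 m0 M0 biL]]]] := phi_bilipschitz a0 a1 x0 x1.
set tau := phi a x in tau0 tau2.
have g0 : 0 < `|gamma| by rewrite normr_gt0.
pose K : R := (`|gamma| * m)^-1.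
have K0 : 0 < K by rewrite invr_gt0 mulr_gt0.
(* The bound 1 keeps [delta * rho <= rho]. The other makes the upper Lipschitz constant of [h] times
   [delta * rho] at most [(v - u) / 2]. *)
pose delta : R := Num.min 1 ((v - u) * m / (4 * M)).
have delta0 : 0 < delta.
  by rewrite lt_min ltr01 divr_gt0// ?mulr_gt0// subr_gt0.
have delta1 : delta <= 1 by rewrite ge_min lexx.
exists delta => // e N e0.
have ln2 : 0 < ln 2 :> R by rewrite ln_gt0// ltr1n.
have e0' : 0 < Num.min eta e / (2 * K).
  by rewrite divr_gt0 ?mulr_gt0// lt_min eta0.
(* With [lam = ln n] and T = n^tau, the conditions in turn serve to drop 1/lam when bounding [rho],
   to get [rho * T < c / 8], to keep n^phi within a factor 2 of T, to get [2 * rho < Num.min eta e],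
   and to get T/n^2 < c/4. The last one relies on tau < 2. *)
have : \forall n \near \oo, [/\ 1 < ln (n%:R : R), 8 * K / c < ln (n%:R : R),
    (n%:R : R) `^ (- tau) < ln 2 / (2 * M * K),
    (n%:R : R) `^ (- tau) < Num.min eta e / (2 * K) &
    (n%:R : R) `^ (- (2 - tau)) < c / 4].
  near=> n; split; near: n.
  - exact: ln_natr_unbounded.
  - exact: ln_natr_unbounded.
  - by apply: powR_natr_small => //; rewrite divr_gt0 ?mulr_gt0.
  - exact: powR_natr_small.
  - by apply: powR_natr_small; rewrite ?subr_gt0// divr_gt0.
move=> [N0 _ N0P].
have [n [p [nN n0 xnp]]] := dirichlet_unbounded x (maxn N N0).
have n0R : 0 < n%:R :> R by rewrite ltr0n.
move: nN; rewrite geq_max => /andP[NN /N0P[]].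
set lam := ln (n%:R : R).
have nE : n%:R = expR lam by rewrite lnK ?posrE.
have pwE z : (n%:R : R) `^ z = expR (z * lam) by rewrite /powR gt_eqF.
rewrite !pwE !mulNr !expRN.
set T := expR (tau * lam) => lam1 lamK TM Tmin Tn.
have T0 : 0 < T by exact: expR_gt0.
have lam0 : 0 < lam by lra.
(* [K] makes the variation of [h] over [x - rho, x + rho] at least 1. *)
pose rho : R := K / (lam * T).
have rho0 : 0 < rho by rewrite divr_gt0// mulr_gt0.
have rho_min : 2 * rho < Num.min eta e.
  move: Tmin; rewrite ltr_pdivlMr ?mulr_gt0//; apply: le_lt_trans.
  rewrite (_ : 2 * rho = T^-1 * (2 * K) / lam).
    by rewrite ler_pdivrMr// ler_peMr ?ltW// mulr_gt0 ?invr_gt0 ?mulr_gt0.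
  by rewrite /rho; field; rewrite !gt_eqF.
have : 2 * rho < eta /\ 2 * rho < e by apply/andP; rewrite -lt_min.
move=> [rho_eta rho_e].
have near_x y : `|y - x| <= 2 * rho -> `|y - x| < eta.
  by move=> /le_lt_trans; apply.
have phi_near y : `|y - x| <= 2 * rho ->
    tau * lam - ln 2 <= phi a y * lam <= tau * lam + ln 2.
  move=> yx; have [_ _ /(_ x)] := biL _ (near_x _ yx).
  rewrite subrr normr0 => /(_ eta0)/andP[_]; rewrite -/tau => hM.
  rewrite -ler_distl -mulrBl normrM (gtr0_norm lam0).
  apply: (@le_trans _ _ (M * (2 * rho) * lam)).
    by rewrite ler_pM2r// (le_trans hM)// ler_pM2l.
  rewrite (_ : _ * lam = T^-1 * (2 * M * K)).
    by rewrite -ler_pdivlMr ?mulr_gt0// ltW.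
  by rewrite /rho; field; rewrite !gt_eqF.
have hlo : expR (tau * lam - ln 2) = T / 2 by rewrite expRD expRN lnK ?posrE.
have hhi : expR (tau * lam + ln 2) = T * 2 by rewrite expRD lnK ?posrE.
pose h y := gamma * expR (phi a y * lam).
have h_bilip s t : `|s - x| <= 2 * rho -> `|t - x| <= 2 * rho ->
    `|gamma| * (T / 2) * (lam * (m * `|s - t|)) <= `|h s - h t| <=
    `|gamma| * (T * 2) * (lam * (M * `|s - t|)).
  move=> sx tx; have [_ _ /(_ t (near_x _ tx))/andP[b1 b2]] := biL _ (near_x _ sx).
  have /andP[] := expR_bilipschitz (phi_near _ sx) (phi_near _ tx).
  rewrite hlo hhi -!mulrBl normrM (gtr0_norm lam0) => e1 e2.
  rewrite /h -mulrBr normrM -2!(mulrA `|gamma|) !(ler_pM2l g0).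
  apply/andP; split.
    apply: le_trans e1; rewrite ler_pM2l ?divr_gt0//.
    by rewrite [leLHS]mulrC ler_pM2r.
  apply: (le_trans e2); rewrite ler_pM2l ?mulr_gt0//.
  by rewrite [leRHS]mulrC ler_pM2r.
have [||||||s [k [sx sk]]] := @preimage_of_period R h x rho
   (`|gamma| * (T * 2) * lam * M) u v (delta * rho) rho0.
- by rewrite mulr_gt0//= ler_piMl// ltW.
- by rewrite !mulr_gt0.
- apply: (@le_trans _ _ (2 * M / m * ((v - u) * m / (4 * M)))).
    rewrite (_ : _ * (delta * rho) = 2 * M / m * delta).
      by rewrite ler_pM2l ?divr_gt0 ?mulr_gt0// ge_min lexx orbT.
    by rewrite /rho /K; field; rewrite !gt_eqF.
  rewrite le_eqVlt; apply/orP; left; apply/eqP.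
  by field; rewrite !gt_eqF.
- apply: continuous_in_subspaceT => y; rewrite inE/= in_itv/= => yI.
  have yx : `|y - x| <= 2 * rho by rewrite ler_norml; lra.
  have [y0 y1 _] := biL y (near_x y yx).
  apply: cvgM; first exact: cvg_cst.
  apply: (@continuous_comp _ _ _ (fun y => phi a y * lam) expR); last first.
    exact: continuous_expR.
  apply: cvgM; last exact: cvg_cst.
  apply: cvgV.
    by rewrite mulf_neq0// ?invr_eq0 ln_eq0.
  by apply: cvgM; [exact: continuous_ln|exact: cvg_cst].
- move=> s t sx tx; have /andP[_] := h_bilip _ _ sx tx.
  by rewrite !mulrA.
- have nr : `|x + rho - x| <= 2 * rho by rewrite addrAC subrr add0r gtr0_norm//; lra.
  have nr' : `|x - rho - x| <= 2 * rho.
    by rewrite addrAC subrr add0r normrN gtr0_norm//; lra.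
  have /andP[+ _] := h_bilip _ _ nr nr'; apply: le_trans.
  rewrite (_ : x + rho - (x - rho) = 2 * rho); last by ring.
  rewrite [`|2 * rho|]gtr0_norm ?(mulr_gt0 _ rho0)// le_eqVlt; apply/orP; left; apply/eqP.
  by rewrite /rho /K; field; rewrite !gt_eqF.
exists n, rho, s.
have ball_sub y : `|y - s| < delta * rho -> `|y - x| < 2 * rho.
  move=> ys; rewrite (_ : y - x = (y - s) + (s - x)); last by ring.
  rewrite (le_lt_trans (ler_normD _ _))// mulr_natl mulr2n ltr_leD//.
  by rewrite (lt_le_trans ys)// ler_piMl// ltW.
split => //; first by rewrite rho0/=; lra.
move=> y ys; split => //; last first.
  by exists k; have := sk y ys; rewrite /h pwE.
exists p; have yx := ltW (ball_sub _ ys).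
have /andP[_] := phi_near _ yx; rewrite -ler_expR hhi => HT.
rewrite pwE mulrBl mul1r expRD expRN -nE invfM invrK.
set H := expR _ in HT *; have H0 : 0 < H := expR_gt0 _.
rewrite (_ : y * n%:R - p%:~R = (y - x) * n%:R + (x * n%:R - p%:~R)); last by ring.
rewrite (le_trans (ler_normD _ _))// normrM (gtr0_norm n0R).
apply: (@le_trans _ _ (2 * rho * n%:R + n%:R^-1)).
  by rewrite lerD// ler_pM2r.
(* Since n^phi(y) <= 2T, the allowed error is at least this. After multiplication by 2T, the terms
   from [rho] and from 1/n each take at most half of [c * n]. *)
apply: (@le_trans _ _ (c * n%:R / (T * 2))); last first.
  by rewrite -mulrA [_^-1 * _]mulrC !mulrA ler_pM2l ?mulr_gt0// lef_pV2 ?posrE ?mulr_gt0.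
rewrite ler_pdivlMr ?mulr_gt0//.
have rT : rho * T < c / 8.
  rewrite (_ : rho * T = K / lam); last by rewrite /rho; field; rewrite !gt_eqF.
  by rewrite ltr_pdivrMr// mulrC -ltr_pdivrMr ?divr_gt0// invf_div mulrCA mulrA.
have Tn2 : T / n%:R ^+ 2 < c / 4.
  suff <- : (expR ((2 - tau) * lam))^-1 = T / n%:R ^+ 2 by [].
  rewrite mulrBl expRD expRN -/T mulr_natl mulr2n expRD -nE.
  by field; rewrite !gt_eqF.
rewrite (_ : (_ + _) * _ = n%:R * (4 * (rho * T) + 2 * (T / n%:R ^+ 2))).
  by rewrite [leRHS]mulrC ler_pM2l//; lra.
by field; rewrite gt_eqF.
Unshelve. all: by end_near. Qed.

(** * Infinitely many solutions almost everywhere, by Lebesgue density *)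

Lemma dist_int_le (R : realType) (x : R) (p : int) : dist_int x <= `|x - p%:~R|.
Proof.
apply: ge_inf; last by exists p.
by exists 0 => _ [m _ <-]; exact: normr_ge0.
Qed.

Lemma fract_eq (R : realType) (x : R) (k : int) : 0 <= x - k%:~R < 1 ->
  fract x = x - k%:~R.
Proof.
move=> xk; rewrite /fract (_ : Num.floor x = k)//; apply: floor_def.
by rewrite intrD; lra.
Qed.

Lemma finite_nat_ubound (A : set nat) :
  finite_set A -> exists N, forall n, (N <= n)%N -> ~ A n.
Proof.
move=> /finite_seqP[s ->]; exists (\max_(i <- s) i).+1 => n + /= ns.
by rewrite leqNgt ltnS leq_bigmax_seq.
Qed.

Lemma ae_infinite_solutions (R : realType) (I : set R) (a c gamma : R) :
    I `<=` [set x | 0 <= x < 1] -> I° !=set0 ->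
    0 < a -> a != 1 -> 0 < c -> gamma != 0 ->
  {ae (@lebesgue_measure R), forall x : R, 0 < x -> x != 1 ->
     0 < phi a x < 2 -> infinite_set (solutions I a c gamma x)}.
Proof.
move=> I01 [y0 /nbhs_ballP[r /= r0 Ir]] a0 a1 c0 gamma0.
have uv : y0 - r < y0 + r by lra.
pose Sol n : set R := [set x | solutions I a c gamma x n].
(* Taking interiors makes [W N] open, hence measurable. *)
pose W N := \bigcup_(n in [set n | (N <= n)%N]) (Sol n)°.
have oW N : open (W N) by apply: bigcup_open => n _; exact: open_interior.
have := ae_foralln (fun N => lebesgue_density (open_measurable (oW N))).
apply: filterS => x dens x0 x1 tau /finite_nat_ubound[N SolN].
have xW : x \notin W N.
  apply/negP; rewrite inE => -[n /= Nn /interior_subset].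
  exact: SolN.
have [delta delta0 hloc] := local_solutions a0 a1 c0 gamma0 uv x0 x1 tau.
(* Outside [W N] the density of [W N] is 0, hence below [delta / 2] at small radii. The solution
   interval of length [2 * delta * rho] inside the ball of length [4 * rho] contradicts this. *)
have := dens N; rewrite indicE (negbTE xW) => /(_ [set z | (z < (delta / 2)%:E)%E]).
have /[swap]/[apply] : nbhs (0%:E : \bar R) [set z | (z < (delta / 2)%:E)%E].
  apply: open_nbhs_nbhs; split; first exact: open_ereal_lt_ereal.
  by rewrite /= lte_fin divr_gt0.
move=> /nbhs_ballP[e /= e0 he].
have e20 : 0 < e / 2 by rewrite divr_gt0.
have [n [rho [s [Nn /andP[rho0 rhoe] subx sol]]]] := hloc (e / 2) N e20.
have rho20 : 0 < 2 * rho by rewrite mulr_gt0.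
have rho2e : ball 0 e (2 * rho) by rewrite /ball/= sub0r normrN gtr0_norm//; lra.
have := he _ rho2e rho20; apply/negP; rewrite -leNgt.
have sW : ball s (delta * rho) `<=` W N `&` ball x (2 * rho).
  move=> y ys; have ys' : `|y - s| < delta * rho by rewrite distrC.
  split; last by rewrite /ball/= distrC; exact: subx.
  exists n => //; suff : ball s (delta * rho) `<=` (Sol n)° by apply.
  rewrite -open_subsetE; last exact: ball_open.
  move=> {ys ys'} {}y ys; have ys' : `|y - s| < delta * rho by rewrite distrC.
  have [n0 [p yp] [k kI]] := sol y ys'.
  have Ik : I (gamma * n%:R `^ phi a y - k%:~R).
    by apply: Ir; rewrite /ball/= ltr_norml; lra.
  split => //; first exact: le_trans (dist_int_le _ p) yp.
  (* As [I] lies in [0, 1), a shift by [k] that lands in [I] is the fractional part. *)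
  by rewrite (fract_eq (k := k)) //; exact: I01.
have dr0 : 0 < delta * rho by rewrite mulr_gt0.
rewrite (lebesgue_measure_ball _ (ltW rho20)).
have : ((delta * rho *+ 2)%:E <=
    lebesgue_measure (W N `&` ball x (2 * rho)))%E.
  rewrite -(lebesgue_measure_ball s (ltW dr0)).
  rewrite le_measure ?inE//.
  - by apply: open_measurable; exact: ball_open.
  - by apply: open_measurable; apply: openI => //; exact: ball_open.
rewrite inver gt_eqF ?mulrn_wgt0// lee_pdivlMr ?mulrn_wgt0//.
apply: le_trans; rewrite lee_fin.
by rewrite le_eqVlt; apply/orP; left; apply/eqP; field.
Qed.

(** * Finitely many solutions almost everywhere, by Borel-Cantelli *)

(** Telescoping: for N > 0 the new term is at most (N^(-s) - (N+1)^(-s))/s. The summand 1 in the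
    bound pays for the first term. *)
Lemma riemannR_partial_sum (R : realType) (s : R) (N : nat) : 0 < s ->
  \sum_(i < N) (i.+1%:R : R) `^ (- (1 + s)) <= 1 + s^-1 - N%:R `^ (- s) / s.
Proof.
move=> s0; elim: N => [|N IH].
  (* By convention 0 to a nonzero power is 0, even for a negative exponent, so the passage from N =
     0 to 1 is treated apart. *)
  by rewrite big_ord0 powR0 ?oppr_eq0 ?gt_eqF// mul0r subr0 addr_ge0// invr_ge0 ltW.
case: (posnP N) => [->|N0].
  by rewrite big_ord1 !powR1; lra.
rewrite big_ord_recr/= (le_trans (lerD IH (lexx _)))//.
have NR0 : 0 < N%:R :> R by rewrite ltr0n.
have NS0 : 0 < N.+1%:R :> R by rewrite ltr0n.
suff : N.+1%:R `^ (- (1 + s)) <= (N%:R `^ (- s) - N.+1%:R `^ (- s)) / s.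
  by rewrite mulrBl; lra.
rewrite ler_pdivlMr// /powR !gt_eqF//.
set A := ln N%:R; set B := ln N.+1%:R.
(* Combined with e^t >= 1 + t at [t = s * (B - A)], after factoring out e^(-sB). *)
have BA : N.+1%:R^-1 <= B - A.
  have NN : N%:R <= (N.+1%:R : R) <= N.+1%:R by rewrite ler_nat leqnSn lexx.
  have NN' : N%:R <= (N%:R : R) <= N.+1%:R by rewrite lexx ler_nat leqnSn.
  have /andP[+ _] := ln_bilipschitz NR0 NN NN'.
  rewrite -natr1 addrAC subrr add0r normr1 mulr1 natr1 ger0_norm//.
  by rewrite subr_ge0 ler_ln ?posrE// ler_nat.
have -> : - (1 + s) * B = - s * B - B by ring.
rewrite (_ : - s * A = - s * B + s * (B - A)); last by ring.
rewrite !expRD expRN lnK ?posrE// -[X in _ <= _ - X]mulr1 -mulrBr -mulrA.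
rewrite ler_pM2l ?expR_gt0//.
apply: (@le_trans _ _ (s * (B - A))); first by rewrite mulrC ler_pM2l.
by have := expR_ge1Dx (s * (B - A)); lra.
Qed.

Lemma riemannR_summable (R : realType) (C s : R) : 0 <= C -> 0 < s ->
  (\sum_(0 <= i <oo) (C * (i.+1%:R : R) `^ (- (1 + s)))%:E < +oo)%E.
Proof.
move=> C0 s0.
apply: (@le_lt_trans _ _ (C * (1 + s^-1))%:E); last exact: ltry.
apply: lime_le.
  by apply: is_cvg_nneseries => n _ _; rewrite lee_fin mulr_ge0// powR_ge0.
apply: nearW => N; rewrite sumEFin lee_fin big_mkord -mulr_sumr ler_wpM2l//.
apply: le_trans (riemannR_partial_sum N s0) _.
by rewrite gerBl divr_ge0 ?powR_ge0 ?ltW.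
Qed.

(** For |x| <= j, failure at denominator n + 1 puts [x] in one of O(n + 1) balls of radius C
    (n+1)^(-(2+s)); the total measures are summable. The countably many [j] then cover the line. *)
Lemma ae_badly_approximable (R : realType) (C s : R) : 0 <= C -> 0 < s ->
  {ae (@lebesgue_measure R), forall x : R, exists N, forall n (p : int), (N <= n)%N ->
     C * n.+1%:R `^ (- (1 + s)) <= `|x * n.+1%:R - p%:~R|}.
Proof.
move=> C0 s0; pose pw n : R := n.+1%:R `^ (- (1 + s)).
have pw1 n : pw n <= 1 by rewrite -[leRHS](powRr0 n.+1%:R) ler_powR ?ler1n// oppr_le0; lra.
suff bounded (j : nat) : {ae (@lebesgue_measure R), forall x : R, `|x| <= j%:R ->
    exists N, forall n (p : int), (N <= n)%N ->
      C * pw n <= `|x * n.+1%:R - p%:~R|}.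
  have := ae_foralln bounded; apply: filterS => x /(_ (Num.truncn `|x|).+1).
  by apply; exact/ltW/truncnS_gt.
(* An error below [C * pw n <= C < B] forces the numerator to satisfy |p| < [M n]. Numerators are
   indexed by naturals through the shift i = p + [M n]. *)
pose B := (Num.truncn C).+1.
have CB : C < B%:R by exact: truncnS_gt.
pose M n := (n.+1 * j + B)%N.
pose cen n i : R := (i%:R - (M n)%:R) / n.+1%:R.
pose rad n : R := C * pw n / n.+1%:R.
have rad0 n : 0 <= rad n by rewrite divr_ge0 ?mulr_ge0 ?powR_ge0.
pose A n : set R := \bigcup_(i in `I_(2 * M n).+1) ball (cen n i) (rad n).
have mball (y r : R) : measurable (ball y r).
  by apply: open_measurable; exact: ball_open.
have mA n : measurable (A n) by exact: bigcup_measurable.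
have A0 : lebesgue_measure (lim_sup_set A) = 0%E.
  apply: lim_sup_set_cvg0 => //.
  have D0 : 0 <= 2 * C * (2 * j + 2 * B + 1)%:R by rewrite !mulr_ge0.
  apply: le_lt_trans (riemannR_summable D0 s0).
  apply: lee_nneseries => // n _; rewrite /A bigcup_mkord.
  have := @Boole_inequality _ _ _ (@lebesgue_measure R)
    (fun i => ball (cen n i) (rad n)) (2 * M n).+1 (fun i _ => mball _ _).
  move=> /le_trans; apply.
  rewrite (eq_bigr (fun=> (rad n *+ 2)%:E)); last first.
    by move=> i _; exact: lebesgue_measure_ball.
  rewrite sumEFin lee_fin big_const_ord iter_addr_0 -mulrnA -[rad n *+ _]mulr_natr.
  rewrite natrM -/(pw n) [leRHS]mulrAC.
  rewrite /rad (_ : _ * _ = 2 * C * pw n * ((2 * M n).+1%:R / n.+1%:R)); last by ring.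
  rewrite ler_wpM2l ?mulr_ge0 ?powR_ge0// ler_pdivrMr// -natrM ler_nat /M.
  nia.
exists (lim_sup_set A); split => //.
  apply: bigcap_measurable => // k _.
  by apply: bigcup_measurable => i _; exact: mA.
move=> x nP; apply: contrapT => nA; apply: nP => xj.
have [N AN] : exists N, forall n, (N <= n)%N -> ~ A n x.
  move/existsNP: nA => [N /not_implyP[_ AN]].
  by exists N => n Nn Anx; apply: AN; exists n.
exists N => n p Nn; rewrite leNgt; apply/negP => xnp; apply: (AN n Nn).
have n0 : 0 < n.+1%:R :> R by [].
have pM : `|p%:~R| < (M n)%:R :> R.
  rewrite natrD natrM; have -> : p%:~R = x * n.+1%:R - (x * n.+1%:R - p%:~R) by ring.
  apply: le_lt_trans (ler_normB _ _) _; apply: ler_ltD.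
    by rewrite normrM mulrC ger0_norm// ler_pM2l.
  rewrite (lt_le_trans xnp)// (le_trans _ (ltW CB))//.
  by rewrite ler_piMr.
have pM' : (`|p| < (M n)%:Z)%R.
  by rewrite -(ltr_int R) intr_norm -pmulrn.
exists (absz (p + (M n)%:Z)).
  by rewrite /=; move: pM'; move: (M n) => ?; lia.
have -> : cen n (absz (p + (M n)%:Z)) = p%:~R / n.+1%:R.
  rewrite /cen [X in X - _]pmulrn gez0_abs; last by move: pM'; move: (M n) => ?; lia.
  by rewrite intrD -pmulrn addrK.
rewrite /ball/= distrC ltr_pdivlMr// -[X in _ * X](gtr0_norm n0) -normrM.
by rewrite mulrBl divfK ?gt_eqF.
Qed.

(** The exponent depends on [x], while each null set belongs to a fixed [s]. The countable family s
    = 1/(k+1) suffices: some [k] has 1/(k+1) <= [phi a x - 2]. *)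
Lemma ae_finite_solutions (R : realType) (I : set R) (a c gamma : R) : 0 < c ->
  {ae (@lebesgue_measure R), forall x : R,
     2 < phi a x -> finite_set (solutions I a c gamma x)}.
Proof.
move=> c0; have c20 : 0 <= 2 * c by lra.
have := ae_foralln (fun k => @ae_badly_approximable R (2 * c) k.+1%:R^-1 c20
  (ltac:(by rewrite invr_gt0))).
apply: filterS => x bad tau.
pose k := Num.truncn (phi a x - 2)^-1.
have ks : k.+1%:R^-1 <= phi a x - 2.
  by rewrite invf_ple ?posrE// ?subr_gt0// ltW// truncnS_gt.
have [N badN] := bad k.
apply: (@sub_finite_set _ _ `I_N.+1); last exact: finite_II.
move=> [|n] [//= _ xn _]; rewrite ltnS ltnNge; apply/negP => Nn.
have pw0 : 0 < c / n.+1%:R `^ (phi a x - 1) by rewrite divr_gt0// powR_gt0.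
(* Doubling [c] makes the inequality strict, so that the infimum yields an actual integer [p]. *)
have : dist_int (x * n.+1%:R) < 2 * (c / n.+1%:R `^ (phi a x - 1)) by lra.
move=> /inf_lt[|_ [p _ <-]]; first by exists `|x * n.+1%:R - 0%:~R|, 0.
apply/negP; rewrite -leNgt; apply: le_trans (badN n p Nn).
rewrite mulrA ler_pM2l ?mulr_gt0// -powRN ler_powR ?ler1n//.
by move: (phi a x) (k.+1%:R^-1) ks => z w; lra.
Qed.

(** * The threshold at the square root of [a], and the conclusion *)

Lemma ln_sqrtr (R : realType) (a : R) : 0 < a -> ln (Num.sqrt a) = ln a / 2.
Proof.
move=> a0; have sq0 : 0 < Num.sqrt a by rewrite sqrtr_gt0.
by rewrite -[X in ln X / 2](sqr_sqrtr (ltW a0)) lnXn// -mulr_natl; field.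
Qed.

(** Comparing ln a / ln x with 2 compares ln x with ln a / 2. Here ln x < 0 reverses the inequality,
    which is why the two sides of the threshold swap when a > 1. *)
Lemma phi_itv_lt1 (R : realType) (a x : R) : 0 < a -> a < x < 1 ->
  [/\ 0 < phi a x, (phi a x < 2) = (x < Num.sqrt a) &
    (2 < phi a x) = (Num.sqrt a < x)].
Proof.
move=> a0 /andP[ax x1].
have x0 : 0 < x := lt_trans a0 ax.
have sq0 : 0 < Num.sqrt a by rewrite sqrtr_gt0.
have lx : ln x < 0 by rewrite ln_lt0// x0.
have la : ln a < 0 by rewrite ln_lt0// a0 (lt_trans ax).
rewrite phiE -(ltr_ln x0 sq0) -(ltr_ln sq0 x0) ln_sqrtr//.
split.
- by rewrite nmulr_rgt0 ?invr_lt0.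
- by rewrite ltr_ndivrMr//; apply/idP/idP; lra.
- by rewrite ltr_ndivlMr//; apply/idP/idP; lra.
Qed.

Lemma phi_itv_gt1 (R : realType) (a x : R) :
    1 < x < a ->
  [/\ 0 < phi a x, (phi a x < 2) = (Num.sqrt a < x) &
    (2 < phi a x) = (x < Num.sqrt a)].
Proof.
move=> /andP[x1 xa].
have x0 : 0 < x := lt_trans ltr01 x1.
have a0 : 0 < a := lt_trans x0 xa.
have sq0 : 0 < Num.sqrt a by rewrite sqrtr_gt0.
have lx : 0 < ln x by rewrite ln_gt0.
have la : 0 < ln a by rewrite ln_gt0// (lt_trans x1).
rewrite phiE -(ltr_ln x0 sq0) -(ltr_ln sq0 x0) ln_sqrtr//.
split.
- by rewrite divr_gt0.
- by rewrite ltr_pdivrMr//; apply/idP/idP; lra.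
- by rewrite ltr_pdivlMr//; apply/idP/idP; lra.
Qed.

Theorem theorem3 (R : realType) (I : set R) (a c gamma : R)
  (I01 : I `<=` [set x | 0 <= x < 1])
  (Iint : I° !=set0)
  (a_gt0 : 0 < a) (c_gt0 : 0 < c) (a_neq1 : a != 1)
  (gamma_neq0 : gamma != 0) :
  (a < 1 ->
    {ae (@lebesgue_measure R), forall theta : R, a < theta < 1 ->
      (theta < Num.sqrt a -> infinite_set (solutions I a c gamma theta)) /\
      (Num.sqrt a < theta -> finite_set (solutions I a c gamma theta))}) /\
  (1 < a ->
    {ae (@lebesgue_measure R), forall theta : R, 1 < theta < a ->
      (Num.sqrt a < theta -> infinite_set (solutions I a c gamma theta)) /\
      (theta < Num.sqrt a -> finite_set (solutions I a c gamma theta))}).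
Proof.
have inf := ae_infinite_solutions I01 Iint a_gt0 a_neq1 c_gt0 gamma_neq0.
have fin := ae_finite_solutions I a gamma c_gt0.
have ae_filter := ae_filter_ringOfSetsType (@lebesgue_measure R).
split=> a1; move: inf fin; apply: filterS2 => x xinf xfin xa.
- have [tau0 tau_lt tau_gt] := phi_itv_lt1 a_gt0 xa.
  rewrite -tau_lt -tau_gt; split=> // tau2.
  have /andP[ax x1] := xa.
  by apply: xinf; rewrite ?tau0 ?lt_eqF// (lt_trans a_gt0).
- have [tau0 tau_lt tau_gt] := phi_itv_gt1 xa.
  rewrite -tau_lt -tau_gt; split=> // tau2.
  have /andP[x1 ax] := xa.
  by apply: xinf; rewrite ?tau0 ?gt_eqF// (lt_trans ltr01).
Qed.
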